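(* Let $a<b$, $n\ge 1$, let $P_1=P_1^T\in\mathbb{R}^{n\times n}$ be invertible and $P_0=-P_0^T\in\mathbb{R}^{n\times n}$. Let $\mathcal{X}=L^2([a,b];\mathbb{R}^n)$ with the standard inner product $\langle\cdot,\cdot\rangle_{L^2}$, let $Z$ be a real Hilbert space, let $H\in\mathcal{L}(Z,\mathcal{X})$ and let $H^*\in\mathcal{L}(\mathcal{X},Z)$ be its adjoint. Fix a real number $\delta t>0$. For $e\in H^1([a,b];\mathbb{R}^n)$ put $\mathcal{J}e:=P_1\frac{de}{d\zeta}+P_0e$. On $\mathcal{B}=\mathcal{F}\times\mathcal{E}$ with $\mathcal{F}=\mathcal{E}=\mathcal{X}\times Z\times\mathbb{R}^n$, whose elements are written $(\delta f_\varepsilon,\delta f_w,\delta f_\partial,e_\varepsilon,e_w,e_\partial)$, consider the symmetric bilinear pairing $$\langle b^1,b^2\rangle_+=\langle e^1_\varepsilon,\delta f^2_\varepsilon\rangle_{L^2}+\langle e^2_\varepsilon,\delta f^1_\varepsilon\rangle_{L^2}-\langle e^1_\partial,\delta f^2_\partial\rangle_{\mathbb{R}^n}-\langle e^2_\partial,\delta f^1_\partial\rangle_{\mathbb{R}^n}-\langle e^1_w,\delta f^2_w\rangle_Z-\langle e^2_w,\delta f^1_w\rangle_Z.$$ Define $$\mathcal{D}=\Big\{(\delta f_\varepsilon,\delta f_w,\delta f_\partial,e_\varepsilon,e_w,e_\partial)\in\mathcal{B}:\ e_\varepsilon\in H^1([a,b];\mathbb{R}^n),\ \delta f_\varepsilon=\mathcal{J}e_\varepsilon\,\delta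 t+H\delta f_w,\ \delta f_\partial=\tfrac{1}{\sqrt2}P_1\big(e_\varepsilon(b)-e_\varepsilon(a)\big)\delta t,\ e_\partial=\tfrac{1}{\sqrt2}\big(e_\varepsilon(b)+e_\varepsilon(a)\big),\ e_w=H^*e_\varepsilon\Big\}.$$ Then $\mathcal{D}$ is a Dirac structure, i.e. $\mathcal{D}^\perp=\mathcal{D}$, where $\mathcal{D}^\perp=\{b\in\mathcal{B}:\langle b,v\rangle_+=0\ \text{for all } v\in\mathcal{D}\}$.
   Context: This is the port structure of a stochastic port-Hamiltonian system $\delta\varepsilon=\mathcal{A}\varepsilon\,\delta t+H(\varepsilon)\delta w$ (Stratonovich sense) with $\mathcal{A}\varepsilon=P_1\frac{\partial}{\partial\zeta}(\mathcal{H}\varepsilon)+P_0\mathcal{H}\varepsilon$; here $e_\varepsilon=\mathcal{H}\varepsilon$ is the effort, $\delta f_\varepsilon=\delta\varepsilon$ the flow, $\delta f_w=\delta w$ the noise flow, $e_w=H^*e_\varepsilon$ the noise effort, and $\delta f_\partial,e_\partial$ the boundary ports. The noise intensity operator is considered at a frozen state, i.e. as a fixed $H\in\mathcal{L}(Z,\mathcal{X})$, and the time increment $\delta t$ is treated as a fixed positive scalar. Equivalently, $\begin{pmatrix}\delta f_\partial\\ e_\partial\delta t\end{pmatrix}=R_0\begin{pmatrix}e_\varepsilon(b)\\ e_\varepsilon(a)\end{pmatrix}\delta t$ with $R_0=\frac{1}{\sqrt2}\begin{pmatrix}P_1&-P_1\\ I&I\end{pmatrix}$. *)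

(* Defs.v *)
From HB Require Import structures.
From mathcomp Require Import all_boot all_order all_algebra.
From mathcomp Require Import all_classical all_reals all_analysis.
Set Implicit Arguments. Unset Strict Implicit. Unset Printing Implicit Defensive.
Import Order.TTheory GRing.Theory Num.Theory.
Import numFieldNormedType.Exports.
Local Open Scope classical_set_scope.
Local Open Scope ring_scope.

(* Functions [a,b] -> R^n are represented by functions R -> 'cV[R]_n;
   only their values on [a,b] matter, up to Lebesgue-a.e. equality. *)

Definition isL2 (R : realType) (n : nat) (a b : R) (f : R -> 'cV[R]_n) : Prop :=
  forall i : 'I_n,
    measurable_fun `[a, b] (fun x => f x i 0) /\
    (lebesgue_measure : measure _ R).-integrable `[a, b]
       (fun x => ((f x i 0) ^+ 2)%:E).

Definition ae_eq (R : realType) (n : nat) (a b : R) (f g : R -> 'cV[R]_n) : Prop :=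
  {ae (lebesgue_measure : measure _ R), forall x, a <= x <= b -> f x = g x}.

Definition ipL2 (R : realType) (n : nat) (a b : R) (f g : R -> 'cV[R]_n) : R :=
  \sum_(i < n) Rintegral (lebesgue_measure : measure _ R) `[a, b]
                 (fun x => f x i 0 * g x i 0).

Definition ipRn (R : realType) (n : nat) (u v : 'cV[R]_n) : R :=
  \sum_(i < n) u i 0 * v i 0.

Definition vint (R : realType) (n : nat) (a x : R) (g : R -> 'cV[R]_n) : 'cV[R]_n :=
  \col_(i < n) Rintegral (lebesgue_measure : measure _ R) `[a, x] (fun t => g t i 0).

(* e is (a representative of) an element of H^1([a,b];R^n), with absolutely
   continuous representative eh and weak derivative g in L^2:
   eh(x) = eh(a) + \int_a^x g  on [a,b], and e = eh a.e. on [a,b]. *)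
Definition H1_rep (R : realType) (n : nat) (a b : R)
    (e eh g : R -> 'cV[R]_n) : Prop :=
  isL2 a b g /\
  (forall x, a <= x <= b -> eh x = eh a + vint a x g) /\
  ae_eq a b e eh.

Definition hilbert_ip (R : realType) (Z : completeNormedModType R)
    (ip : Z -> Z -> R) : Prop :=
  (forall z w, ip z w = ip w z) /\
  (forall (k : R) z1 z2 w, ip (k *: z1 + z2) w = k * ip z1 w + ip z2 w) /\
  (forall z, ip z z = `|z| ^+ 2).

Definition bounded_op (R : realType) (n : nat) (a b : R)
    (Z : completeNormedModType R) (H : Z -> R -> 'cV[R]_n) : Prop :=
  (forall z, isL2 a b (H z)) /\
  (forall (k : R) z w, ae_eq a b (H (k *: z + w)) (fun x => k *: H z x + H w x)) /\
  (exists C : R, forall z, Num.sqrt (ipL2 a b (H z) (H z)) <= C * `|z|).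

Definition is_adjoint (R : realType) (n : nat) (a b : R)
    (Z : completeNormedModType R) (ip : Z -> Z -> R)
    (H : Z -> R -> 'cV[R]_n) (Hs : (R -> 'cV[R]_n) -> Z) : Prop :=
  forall (x : R -> 'cV[R]_n) (z : Z), isL2 a b x ->
    ip (Hs x) z = ipL2 a b x (H z).

(* an element (df_eps, df_w, df_bd, e_eps, e_w, e_bd) of B = F x E *)
Record bond (R : realType) (n : nat) (Z : Type) := Bond {
  dfe : R -> 'cV[R]_n;
  dfw : Z;
  dfp : 'cV[R]_n;
  ee  : R -> 'cV[R]_n;
  ew  : Z;
  ep  : 'cV[R]_n }.

Definition inB (R : realType) (n : nat) (a b : R) (Z : Type) (x : bond R n Z) : Prop :=
  isL2 a b (dfe x) /\ isL2 a b (ee x).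

Definition pairing (R : realType) (n : nat) (a b : R)
    (Z : completeNormedModType R) (ip : Z -> Z -> R)
    (b1 b2 : bond R n Z) : R :=
  ipL2 a b (ee b1) (dfe b2) + ipL2 a b (ee b2) (dfe b1)
  - ipRn (ep b1) (dfp b2) - ipRn (ep b2) (dfp b1)
  - ip (ew b1) (dfw b2) - ip (ew b2) (dfw b1).

Definition inD (R : realType) (n : nat) (a b : R)
    (Z : completeNormedModType R)
    (P1 P0 : 'M[R]_n) (H : Z -> R -> 'cV[R]_n) (Hs : (R -> 'cV[R]_n) -> Z)
    (dt : R) (x : bond R n Z) : Prop :=
  inB a b x /\
  exists eh g : R -> 'cV[R]_n,
    H1_rep a b (ee x) eh g /\
    ae_eq a b (dfe x)
      (fun t => dt *: (P1 *m g t + P0 *m eh t) + H (dfw x) t) /\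
    dfp x = (Num.sqrt 2)^-1 *: (dt *: (P1 *m (eh b - eh a))) /\
    ep x = (Num.sqrt 2)^-1 *: (eh b + eh a) /\
    ew x = Hs (ee x).

Definition inDperp (R : realType) (n : nat) (a b : R)
    (Z : completeNormedModType R) (ip : Z -> Z -> R)
    (P1 P0 : 'M[R]_n) (H : Z -> R -> 'cV[R]_n) (Hs : (R -> 'cV[R]_n) -> Z)
    (dt : R) (x : bond R n Z) : Prop :=
  inB a b x /\
  forall v : bond R n Z, inD a b P1 P0 H Hs dt v -> pairing a b ip x v = 0.

(* Main.v *)
(* Green's formula for absolutely continuous functions (integration by parts,
   obtained from Fubini on the triangle s <= x) equates the L^2 terms of the
   pairing of two elements of D with the boundary terms; the noise terms cancel
   by adjointness and the P0 terms by skew-symmetry.  Hence D is isotropic.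

   Conversely, let x be orthogonal to D.  Solve
   dt (P1 g + P0 e) + H df_w = df_eps for g in L^2, and let eh be the primitive
   of g whose boundary values satisfy eh(b) + eh(a) = sqrt 2 * e_bd.  Comparing
   the orthogonality relation with Green's formula for eh leaves, for every
   primitive e' of some g' in L^2 and every w' in Z,
     dt <e - eh, P1 g'> + <H^* e - e_w, w'>
       = <(e'(b) + e'(a)) / sqrt 2, df_bd - dt P1 (eh(b) - eh(a)) / sqrt 2>.
   Taking e' = 0 gives e_w = H^* e, then e' constant gives df_bd, and finally
   g' = P1^-1 (e - eh) gives e = eh almost everywhere. *)

Require Import Defs.
From HB Require Import structures.
From mathcomp Require Import all_boot all_order all_algebra.
From mathcomp Require Import all_classical all_reals all_analysis.
From mathcomp Require Import measurable_realfun ring lra.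
Import Order.TTheory GRing.Theory Num.Theory.
Import numFieldNormedType.Exports.
Local Open Scope ring_scope.
Local Open Scope classical_set_scope.

Set Implicit Arguments.
Unset Strict Implicit.
Unset Printing Implicit Defensive.

(** * Square-integrable scalar functions on an interval and integration by parts *)

Section interval_integrals.
Context (R : realType).
Notation mu := (@lebesgue_measure R).
Notation T := (measurableTypeR R).
Implicit Types (a b c : R) (f g : R -> R).

Lemma ae_lebesgueS (P Q : R -> Prop) : (forall x, P x -> Q x) ->
  {ae mu, forall x, P x} -> {ae mu, forall x, Q x}.
Proof. exact: (@filterS _ _ (ae_filter_ringOfSetsType mu)). Qed.

Lemma ae_lebesgueS2 (P Q S : R -> Prop) : (forall x, P x -> Q x -> S x) ->
  {ae mu, forall x, P x} -> {ae mu, forall x, Q x} -> {ae mu, forall x, S x}.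
Proof. exact: (@filterS2 _ _ (ae_filter_ringOfSetsType mu)). Qed.

(** The scalar condition that [isL2] imposes on each coordinate, in the same form, so that a proof
    of [isL2] applied to an index is a proof of [sqint]. *)
Definition sqint a b f : Prop :=
  measurable_fun `[a, b] f /\ mu.-integrable `[a, b] (fun x => (f x ^+ 2)%:E).

(** Domination: |f g| <= f^2 + g^2. *)
Lemma sqint_integrable_mul a b f g : sqint a b f -> sqint a b g ->
  mu.-integrable `[a, b] (EFin \o (fun x => f x * g x)).
Proof.
move=> [mf f2] [mg g2].
apply: (le_integrable _ _ _ (integrableD _ f2 g2)) => //.
  exact/measurable_EFinP/measurable_funM.
move=> x _ /=; rewrite lee_fin [leRHS]ger0_norm ?addr_ge0 ?sqr_ge0// normrM.
rewrite -(real_normK (num_real (f x))) -(real_normK (num_real (g x))).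
move: (normr_ge0 (f x)) (normr_ge0 (g x)); nra.
Qed.

Lemma sqintD a b f g : sqint a b f -> sqint a b g ->
  sqint a b (fun x => f x + g x).
Proof.
move=> sf sg; have [[mf f2] [mg g2]] := (sf, sg); split.
  exact: measurable_funD.
have fg := sqint_integrable_mul sf sg.
apply: eq_integrable (integrableD _ (integrableD _ f2 g2) (integrableZl _ 2 fg)) => //.
by move=> x _ /=; rewrite -EFinM -!EFinD; congr EFin; ring.
Qed.

Lemma sqintZ a b f (k : R) : sqint a b f -> sqint a b (fun x => k * f x).
Proof.
move=> [mf f2]; split; first exact: measurable_funM.
apply: eq_integrable (integrableZl _ (k ^+ 2) f2) => //.
by move=> x _ /=; rewrite -EFinM; congr EFin; ring.
Qed.

Lemma sqint_continuous a b f : {within `[a, b], continuous f} -> sqint a b f.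
Proof.
move=> cf; split; first exact: subspace_continuous_measurable_fun.
apply: (continuous_compact_integrable (f := fun x => f x ^+ 2)).
  exact: segment_compact.
by move=> x; apply: (continuousM (cf x) (cf x)).
Qed.

Lemma sqint_cst a b (k : R) : sqint a b (fun=> k).
Proof. by apply: sqint_continuous => x; exact: cst_continuous. Qed.

Lemma sqint_sum a b (I : Type) (s : seq I) (F : I -> R -> R) :
  (forall i, sqint a b (F i)) -> sqint a b (fun x => \sum_(i <- s) F i x).
Proof.
move=> sF; elim: s => [|i s IH].
  by under [X in sqint _ _ X]eq_fun do rewrite big_nil; exact: sqint_cst.
under [X in sqint _ _ X]eq_fun do rewrite big_cons; exact: sqintD.
Qed.

(** On a bounded interval L^2 lies in L^1: multiply by the square-integrable constant 1. *)
Lemma sqint_integrable a b f : sqint a b f ->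
  mu.-integrable `[a, b] (EFin \o f).
Proof.
move=> sf; have := sqint_integrable_mul sf (sqint_cst a b 1).
by apply: eq_integrable => // x _ /=; rewrite mulr1.
Qed.

Lemma sqint_primitive a b f : a <= b -> sqint a b f ->
  sqint a b (fun x => \int[mu]_(t in `[a, x]) f t).
Proof.
move=> ab sf; apply: sqint_continuous.
exact: parameterized_integral_continuous (sqint_integrable sf).
Qed.

Lemma sqint_eq a b f g : (forall x, a <= x <= b -> f x = g x) ->
  sqint a b f -> sqint a b g.
Proof.
move=> fg [mf f2].
have fg' : {in `[a, b], f =1 g} by move=> x; rewrite inE/= in_itv/=; exact: fg.
split; first exact: eq_measurable_fun mf.
by apply: eq_integrable f2 => // x /fg' ->.
Qed.

Lemma ae_eq_Rintegral a b f g :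
  measurable_fun `[a, b] f -> measurable_fun `[a, b] g ->
  {ae mu, forall x, a <= x <= b -> f x = g x} ->
  \int[mu]_(x in `[a, b]) f x = \int[mu]_(x in `[a, b]) g x.
Proof.
move=> mf mg fg; congr fine; apply: ae_eq_integral => //;
  try exact/measurable_EFinP.
by apply: ae_lebesgueS fg => x + /=; rewrite in_itv/= => + xab => ->.
Qed.

Lemma Rintegral_sqr_eq0 a b f : sqint a b f ->
  \int[mu]_(x in `[a, b]) (f x * f x) = 0 ->
  {ae mu, forall x, a <= x <= b -> f x = 0}.
Proof.
move=> sf f0; have [mf _] := sf.
have i2 := sqint_integrable_mul sf sf.
(* [fine] sends infinite values to 0, so finiteness is needed to lift the vanishing real integral to
   the extended reals. *)
have fn : (\int[mu]_(x in `[a, b]) (f x * f x)%:E)%E \is a fin_num.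
  exact: integrable_fin_num.
have : (\int[mu]_(x in `[a, b]) `|(f x * f x)%:E| = 0)%E.
  rewrite -[RHS]/(0%:E) -f0 fineK//.
  by apply: eq_integral => x _; rewrite abse_EFin ger0_norm// -expr2 sqr_ge0.
have mff : measurable_fun `[a, b] (EFin \o (fun x => f x * f x)).
  exact/measurable_EFinP/measurable_funM.
move=> /(proj1 (ae_eq_integral_abs mu (measurable_itv _) mff)).
apply: ae_lebesgueS => x /= + xab; rewrite in_itv/= => /(_ xab) [] /eqP.
by rewrite mulf_eq0 orbb => /eqP.
Qed.

(** Fubini for f(s) g(x) times the indicator of s <= x. The integrand is dominated by |f(s) g(x)|,
    whose double integral is the product of the two L^1 norms. *)
Lemma integral_triangle_swap f g :
  mu.-integrable setT (EFin \o f) -> mu.-integrable setT (EFin \o g) ->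
  (\int[mu]_s \int[mu]_x ((f s * g x) * ((s : R) <= x)%R%:R)%:E =
   \int[mu]_x \int[mu]_s ((f s * g x) * ((s : R) <= x)%R%:R)%:E)%E.
Proof.
move=> fi gi.
have [/measurable_EFinP mf fl] := integrableP _ _ _ fi.
have [/measurable_EFinP mg gl] := integrableP _ _ _ gi.
pose F (z : T * T) : \bar R := ((f z.1 * g z.2) * (z.1 <= z.2)%R%:R)%:E.
apply: (@Fubini _ _ _ _ _ mu mu F).
have m1 : measurable_fun setT (fun z : T * T => f z.1).
  exact: measurableT_comp mf measurable_fst.
have m2 : measurable_fun setT (fun z : T * T => g z.2).
  exact: measurableT_comp mg measurable_snd.
pose G (z : T * T) : \bar R := (f z.1 * g z.2)%:E.
have mG : measurable_fun setT G by exact/measurable_EFinP/measurable_funM.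
apply: (@le_integrable _ _ _ _ _ _ F G) => //.
- apply/measurable_EFinP; apply: measurable_funM; first exact: measurable_funM.
  have -> : (fun z : T * T => (z.1 <= z.2)%R%:R : R) =
            \1_[set z : T * T | z.1 <= z.2].
    by apply/funext => z; rewrite indicE mem_setE.
  apply: measurable_indic.
  rewrite -[X in measurable X]setTI.
  by apply: measurable_fun_le.
- move=> z _; rewrite /F /G /= lee_fin normrM ler_piMr//.
  by case: (z.1 <= z.2); rewrite ?normr1 ?normr0.
(* For the dominating product, the iterated integral of absolute values factors into two finite
   integrals. *)
- apply/integrable12ltyP => //; rewrite /G /=.
  under eq_integral.
    move=> x _.
    under eq_integral do rewrite normrM EFinM.
    rewrite ge0_integralZl//; last exact/measurable_EFinP/measurableT_comp.
    over.
  rewrite /= ge0_integralZr//; last 2 first.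
    exact/measurable_EFinP/measurableT_comp.
    exact: integral_ge0.
  by rewrite lte_mul_pinfty// ?integral_ge0// ge0_fin_numE ?integral_ge0.
Qed.

(** Both sides integrate f(s) g(x) over the triangle a <= s <= x <= b, in the two orders. *)
Lemma Rintegral_primitiveM a b f g :
  mu.-integrable `[a, b] (EFin \o f) -> mu.-integrable `[a, b] (EFin \o g) ->
  \int[mu]_(x in `[a, b]) ((\int[mu]_(s in `[a, x]) f s) * g x) =
  \int[mu]_(s in `[a, b]) (f s * \int[mu]_(x in `[s, b]) g x).
Proof.
move=> fi gi.
(* Extension by zero outside [a,b] gives integrable functions on the whole line, as the triangle
   swap requires. *)
have ext (h : R -> R) : mu.-integrable `[a, b] (EFin \o h) ->
    mu.-integrable setT (EFin \o (h \_ `[a, b])).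
  by move=> hi; rewrite -restrict_EFin; exact/(integrable_mkcond _ _).1.
have EFin_sub (h : R -> R) (k c d : R) : a <= c -> d <= b ->
    mu.-integrable `[a, b] (EFin \o h) ->
    (\int[mu]_(t in `[c, d]) (k * h t)%:E)%E =
    (k * \int[mu]_(t in `[c, d]) h t)%:E.
  move=> ac db hi.
  have hi' : mu.-integrable `[c, d] (EFin \o h).
    by apply: integrableS hi => //; apply: subset_itvScc; rewrite bnd_simp.
  rewrite -RintegralZl// fineK//; apply: integrable_fin_num => //.
  exact: eq_integrable (integrableZl _ k hi').
have := integral_triangle_swap (ext _ fi) (ext _ gi).
move=> /(congr1 fine) /esym.
rewrite [X in _ -> X = _]/Rintegral integral_mkcond.
rewrite [X in _ -> _ = X]/Rintegral [X in _ -> _ = fine X]integral_mkcond => E.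
congr (_ = _): E; congr fine; apply: eq_integral => x _.
- rewrite [RHS]patchE; case: ifPn => [|xI]; last first.
    by apply: integral0_eq => s _; rewrite /= !patchE (negPf xI) mulr0 mul0r.
  rewrite inE/= in_itv/= => /andP[ax xb].
  rewrite mulrC -EFin_sub// [RHS]integral_mkcond; apply: eq_integral => s _.
  rewrite /= !patchE !mem_setE !in_itv/= ax xb/=.
  (* For x in [a,b], the cutoffs a <= s <= b and s <= x together amount to s in [a,x];
     symmetrically, the second branch leaves [s,b]. *)
  case: (leP a s) => as_; case: (leP s x) => sx; rewrite ?(le_trans sx xb)/=;
    rewrite ?mulr0 ?mul0r ?mulr1//.
  by rewrite mulrC.
- rewrite [RHS]patchE; case: ifPn => [|xI]; last first.
    by apply: integral0_eq => s _; rewrite /= !patchE (negPf xI) !mul0r.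
  rewrite inE/= in_itv/= => /andP[ax xb].
  rewrite -EFin_sub// [RHS]integral_mkcond; apply: eq_integral => s _.
  rewrite /= !patchE !mem_setE !in_itv/= ax xb/=.
  case: (leP x s) => xs; case: (leP s b) => sb; rewrite ?(le_trans ax xs)/=;
    rewrite ?andbF ?mulr0 ?mul0r ?mulr1//.
Qed.

Lemma Rintegral_sum a b (I : Type) (s : seq I) (F : I -> R -> R) :
  (forall i, mu.-integrable `[a, b] (EFin \o F i)) ->
  \int[mu]_(x in `[a, b]) (\sum_(i <- s) F i x) =
  \sum_(i <- s) \int[mu]_(x in `[a, b]) F i x.
Proof.
move=> iF; elim: s => [|i s IH].
  under eq_Rintegral do rewrite big_nil.
  by rewrite big_nil Rintegral_cst// mul0r.
under eq_Rintegral do rewrite big_cons.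
rewrite big_cons -IH RintegralD//.
have : mu.-integrable `[a, b] (fun x => (\sum_(i <- s) (F i x)%:E)%E).
  have := @integrable_sum _ _ _ mu `[a, b] _ I s xpredT (fun i x => (F i x)%:E).
  apply=> // i0 _; exact: iF.
by apply: eq_integrable => // x _ /=; rewrite sumEFin.
Qed.

(** After the order of integration is exchanged in the first term, the inner integral runs over
    [s,b]; adding the second term completes it to [a,b], and the product of the full integrals
    factors out. *)
Lemma Rintegral_by_parts a b f g : sqint a b f -> sqint a b g -> a <= b ->
  \int[mu]_(x in `[a, b]) ((\int[mu]_(s in `[a, x]) f s) * g x) +
  \int[mu]_(x in `[a, b]) (f x * \int[mu]_(s in `[a, x]) g s) =
  (\int[mu]_(x in `[a, b]) f x) * \int[mu]_(x in `[a, b]) g x.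
Proof.
move=> sf sg ab; have [fi gi] := (sqint_integrable sf, sqint_integrable sg).
rewrite Rintegral_primitiveM//.
have tail s : a <= s <= b -> \int[mu]_(x in `[s, b]) g x =
    \int[mu]_(x in `[a, b]) g x - \int[mu]_(x in `[a, s]) g x.
  (* Splitting [a,b] at s leaves a half-open right piece; the endpoint s carries no mass. *)
  move=> /andP[as_ sb]; rewrite -(@Rintegral_itv_obnd_cbnd _ s); last first.
    by apply: integrableS gi => //; apply: subset_itv; rewrite bnd_simp.
  by rewrite (@Rintegral_itvB _ g (BLeft a) (BRight b) s).
have sG := sqint_primitive ab sg.
rewrite -RintegralD//; last 2 first.
- apply: (sqint_integrable_mul sf).
  apply: sqint_eq (sqintD (sqint_cst a b (\int[mu]_(x in `[a, b]) g x))
                          (sqintZ (-1) sG)) => s sab.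
  by rewrite /= (tail s)// mulN1r.
- exact: sqint_integrable_mul sf sG.
rewrite -RintegralZr//; apply: eq_Rintegral => s.
by rewrite inE/= in_itv/= => sab; rewrite (tail s)//; ring.
Qed.

End interval_integrals.

(** * The inner product of R^n *)

Section euclidean.
Context (R : realType) (n : nat).
Implicit Types (u v w : 'cV[R]_n) (M : 'M[R]_n).

Lemma ipRnC u v : ipRn u v = ipRn v u.
Proof. by apply: eq_bigr => i _; rewrite mulrC. Qed.

Lemma ipRnDl u v w : ipRn (u + v) w = ipRn u w + ipRn v w.
Proof. by rewrite -big_split; apply: eq_bigr => i _; rewrite mxE mulrDl. Qed.

Lemma ipRnZl (k : R) u w : ipRn (k *: u) w = k * ipRn u w.
Proof. by rewrite mulr_sumr; apply: eq_bigr => i _; rewrite mxE mulrA. Qed.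

Lemma ipRnDr u v w : ipRn w (u + v) = ipRn w u + ipRn w v.
Proof. by rewrite !(ipRnC w) ipRnDl. Qed.

Lemma ipRnZr (k : R) u w : ipRn w (k *: u) = k * ipRn w u.
Proof. by rewrite !(ipRnC w) ipRnZl. Qed.

Lemma ipRnBr u v w : ipRn w (u - v) = ipRn w u - ipRn w v.
Proof. by rewrite ipRnDr -scaleN1r ipRnZr mulN1r. Qed.

Lemma ipRn0r u : ipRn u 0 = 0.
Proof. by rewrite -(scale0r 0) ipRnZr mul0r. Qed.

Lemma ipRn_mulmx M u v : ipRn (M *m u) v = ipRn u (M^T *m v).
Proof.
transitivity (\sum_i \sum_j M i j * u j 0 * v i 0).
  by apply: eq_bigr => i _; rewrite mxE mulr_suml.
rewrite exchange_big; apply: eq_bigr => j _; rewrite mxE mulr_sumr.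
by apply: eq_bigr => i _; rewrite !mxE; ring.
Qed.

Lemma ipRn_eq0 u : ipRn u u = 0 -> u = 0.
Proof.
move=> /eqP; rewrite psumr_eq0 => [/allP u0|i _]; last by rewrite -expr2 sqr_ge0.
apply/colP => i; rewrite mxE; apply/eqP.
by have := u0 i (mem_index_enum i); rewrite mulf_eq0 orbb.
Qed.

End euclidean.

(** * The inner product of L^2([a,b];R^n), treated coordinatewise *)

Section L2.
Context (R : realType) (n : nat) (a b : R).
Hypothesis ab : a <= b.
Notation mu := (@lebesgue_measure R).
Implicit Types (f g h : R -> 'cV[R]_n) (M : 'M[R]_n).

Lemma isL2D f g : isL2 a b f -> isL2 a b g -> isL2 a b (fun x => f x + g x).
Proof.
move=> sf sg i; have := sqintD (sf i) (sg i).
by apply: sqint_eq => x _; rewrite mxE.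
Qed.

Lemma isL2Z (k : R) f : isL2 a b f -> isL2 a b (fun x => k *: f x).
Proof.
move=> sf i; have := sqintZ k (sf i).
by apply: sqint_eq => x _; rewrite mxE.
Qed.

Lemma isL2_cst (u : 'cV[R]_n) : isL2 a b (fun=> u).
Proof. move=> i; exact: sqint_cst. Qed.

Lemma isL2_mulmx M f : isL2 a b f -> isL2 a b (fun x => M *m f x).
Proof.
move=> sf i; have := sqint_sum (index_enum _) (fun j => sqintZ (M i j) (sf j)).
by apply: sqint_eq => x _; rewrite mxE.
Qed.

Lemma isL2_vint f : isL2 a b f -> isL2 a b (fun x => vint a x f).
Proof.
move=> sf i; have := sqint_primitive ab (sf i).
by apply: sqint_eq => x _; rewrite mxE.
Qed.

Lemma isL2_eq f g : (forall x, a <= x <= b -> f x = g x) ->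
  isL2 a b f -> isL2 a b g.
Proof. by move=> fg sf i; apply: sqint_eq (sf i) => x /fg ->. Qed.

Lemma ipL2C f g : ipL2 a b f g = ipL2 a b g f.
Proof.
by apply: eq_bigr => i _; apply: eq_Rintegral => x _; rewrite mulrC.
Qed.

Lemma ipL2Dl f g h : isL2 a b f -> isL2 a b g -> isL2 a b h ->
  ipL2 a b (fun x => f x + g x) h = ipL2 a b f h + ipL2 a b g h.
Proof.
move=> sf sg sh; rewrite -big_split; apply: eq_bigr => i _ /=.
rewrite -RintegralD//; [|exact: sqint_integrable_mul (sf i) (sh i)
  |exact: sqint_integrable_mul (sg i) (sh i)].
by apply: eq_Rintegral => x _; rewrite mxE mulrDl.
Qed.

Lemma ipL2Zl (k : R) f h : isL2 a b f -> isL2 a b h ->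
  ipL2 a b (fun x => k *: f x) h = k * ipL2 a b f h.
Proof.
move=> sf sh; rewrite mulr_sumr; apply: eq_bigr => i _.
rewrite -RintegralZl//; last exact: sqint_integrable_mul (sf i) (sh i).
by apply: eq_Rintegral => x _; rewrite mxE mulrA.
Qed.

Lemma ipL2Dr f g h : isL2 a b f -> isL2 a b g -> isL2 a b h ->
  ipL2 a b h (fun x => f x + g x) = ipL2 a b h f + ipL2 a b h g.
Proof. by move=> sf sg sh; rewrite !(ipL2C h) ipL2Dl. Qed.

Lemma ipL2Zr (k : R) f h : isL2 a b f -> isL2 a b h ->
  ipL2 a b h (fun x => k *: f x) = k * ipL2 a b h f.
Proof. by move=> sf sh; rewrite !(ipL2C h) ipL2Zl. Qed.

(** The sum over coordinates moves inside the integral, where the transposition rule of R^n applies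
    pointwise. *)
Lemma ipL2_mulmx M f g : isL2 a b f -> isL2 a b g ->
  ipL2 a b (fun x => M *m f x) g = ipL2 a b f (fun x => M^T *m g x).
Proof.
move=> sf sg.
have ipE h k : isL2 a b h -> isL2 a b k ->
    ipL2 a b h k = \int[mu]_(x in `[a, b]) ipRn (h x) (k x).
  move=> sh sk; rewrite Rintegral_sum// => i.
  exact: sqint_integrable_mul (sh i) (sk i).
rewrite !ipE//; [|exact: isL2_mulmx..].
by apply: eq_Rintegral => x _; rewrite ipRn_mulmx.
Qed.

Lemma ae_eq_ipL2l f g h : isL2 a b f -> isL2 a b g -> isL2 a b h ->
  Defs.ae_eq a b f g -> ipL2 a b f h = ipL2 a b g h.
Proof.
move=> sf sg sh fg; apply: eq_bigr => i _; apply: ae_eq_Rintegral.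
- exact: measurable_funM (sf i).1 (sh i).1.
- exact: measurable_funM (sg i).1 (sh i).1.
by apply: ae_lebesgueS fg => x + xab => ->.
Qed.

Lemma ae_eq_ipL2r f g h : isL2 a b f -> isL2 a b g -> isL2 a b h ->
  Defs.ae_eq a b f g -> ipL2 a b h f = ipL2 a b h g.
Proof. by move=> sf sg sh fg; rewrite !(ipL2C h); exact: ae_eq_ipL2l. Qed.

Lemma ipL2_eq0 f : isL2 a b f -> ipL2 a b f f = 0 ->
  Defs.ae_eq a b f (fun=> 0).
Proof.
move=> sf /eqP; rewrite psumr_eq0 => [/allP f0|i _]; last first.
  by apply: Rintegral_ge0 => x _; rewrite -expr2 sqr_ge0.
have H i : {ae mu, forall x, a <= x <= b -> f x i 0 = 0}.
  by apply: Rintegral_sqr_eq0 => //; exact/eqP/(f0 i (mem_index_enum i)).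
(* The finitely many exceptional null sets, one for each coordinate, are merged into one. *)
have : {ae mu, forall x, forall i : 'I_n, a <= x <= b -> f x i 0 = 0}.
  exact: filter_forall.
apply: ae_lebesgueS => x fx xab; apply/colP => i.
by rewrite mxE; exact: fx.
Qed.

Lemma ipL2_cst (u : 'cV[R]_n) f : isL2 a b f ->
  ipL2 a b (fun=> u) f = ipRn u (vint a b f).
Proof.
move=> sf; apply: eq_bigr => i _; rewrite mxE -RintegralZl//.
exact: sqint_integrable (sf i).
Qed.

(** Integration by parts for primitives vanishing at a, so that only the boundary term at b
    survives. *)
Lemma ipL2_vint f g : isL2 a b f -> isL2 a b g ->
  ipL2 a b (fun x => vint a x f) g + ipL2 a b f (fun x => vint a x g) =
  ipRn (vint a b f) (vint a b g).
Proof.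
move=> sf sg; rewrite -big_split; apply: eq_bigr => i _ /=; rewrite !mxE.
rewrite -Rintegral_by_parts; [|exact: sf|exact: sg|by []].
by congr (_ + _); apply: eq_Rintegral => x _; rewrite mxE.
Qed.

Lemma vint_mulmx M f x : a <= x <= b -> isL2 a b f ->
  vint a x (fun t => M *m f t) = M *m vint a x f.
Proof.
move=> /andP[ax xb] sf; apply/colP => i; rewrite !mxE.
have fi j : mu.-integrable `[a, x] (EFin \o (fun t => f t j 0)).
  apply: integrableS (sqint_integrable (sf j)) => //.
  by apply: subset_itvScc; rewrite bnd_simp.
under eq_Rintegral do rewrite mxE.
rewrite Rintegral_sum => [|j].
  by apply: eq_bigr => j _; rewrite mxE RintegralZl.
exact: eq_integrable (integrableZl _ _ (fi j)).
Qed.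

Lemma vintaa f : vint a a f = 0.
Proof. by apply/colP => i; rewrite !mxE set_itv1 Rintegral_set1. Qed.

End L2.

Lemma ipL20r (R : realType) (n : nat) (a b : R) (f : R -> 'cV[R]_n) :
  ipL2 a b f (fun=> 0) = 0.
Proof.
apply: big1 => i _; under eq_Rintegral do rewrite mxE mulr0.
by rewrite Rintegral_cst// mul0r.
Qed.

(** * Absolutely continuous functions, Green's formula and boundary ports *)

Section green.
Context (R : realType) (n : nat) (a b : R).
Hypothesis ab : a <= b.
Implicit Types (e f g h : R -> 'cV[R]_n) (P : 'M[R]_n).

(** The condition that [H1_rep] puts on the absolutely continuous representative and its weak
    derivative, separated from the a.e. class. *)
Definition is_primitive e g : Prop :=
  isL2 a b g /\ forall x, a <= x <= b -> e x = e a + vint a x g.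

Lemma primitive_isL2 e g : is_primitive e g -> isL2 a b e.
Proof.
move=> [sg eE]; apply: (isL2_eq (f := fun x => e a + vint a x g)).
  by move=> x /eE ->.
by apply: isL2D (isL2_vint ab sg); exact: isL2_cst.
Qed.

Lemma primitive_vint (u : 'cV[R]_n) g : isL2 a b g ->
  is_primitive (fun x => u + vint a x g) g.
Proof. by move=> sg; split=> // x _; rewrite vintaa addr0. Qed.

Lemma primitive_cst (u : 'cV[R]_n) : is_primitive (fun=> u) (fun=> 0).
Proof.
split=> [|x _]; first exact: isL2_cst.
apply/colP => i; rewrite !mxE (_ : Rintegral _ _ _ = 0) ?addr0//.
by rewrite Rintegral_cst// mul0r.
Qed.

Lemma primitive_mulmx P e g : is_primitive e g ->
  is_primitive (fun x => P *m e x) (fun x => P *m g x).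
Proof.
move=> [sg eE]; split=> [|x xab]; first exact: isL2_mulmx.
by rewrite eE// mulmxDr (vint_mulmx _ xab).
Qed.

(** Each function is its value at a plus a primitive vanishing at a. The constants contribute the
    mixed terms, and [ipL2_vint] contributes the product of the increments. *)
Lemma ipL2_by_parts e1 g1 e2 g2 : is_primitive e1 g1 -> is_primitive e2 g2 ->
  ipL2 a b e1 g2 + ipL2 a b g1 e2 = ipRn (e1 b) (e2 b) - ipRn (e1 a) (e2 a).
Proof.
move=> [sg1 e1E] [sg2 e2E].
have bab : a <= b <= b by rewrite ab lexx.
have ipE e g h : (forall x, a <= x <= b -> e x = e a + vint a x g) ->
    isL2 a b g -> isL2 a b h -> ipL2 a b e h =
    ipRn (e a) (vint a b h) + ipL2 a b (fun x => vint a x g) h.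
  move=> eE sg sh; have sv := isL2_vint ab sg.
  rewrite -ipL2_cst// -ipL2Dl//; last exact: isL2_cst.
  apply: eq_bigr => i _; apply: eq_Rintegral => x.
  by rewrite inE/= in_itv/= => xab; rewrite [in LHS]eE.
rewrite (ipL2C a b g1) (ipE e1 g1)// (ipE e2 g2)// (ipL2C a b _ g1).
rewrite addrACA ipL2_vint// (e1E b)// (e2E b)// !ipRnDl !ipRnDr.
by rewrite (ipRnC (vint a b g1) (e2 a)); ring.
Qed.

(** Integration by parts for e1 and P e2, the latter having derivative P g2; symmetry of P then
    moves it onto g1. *)
Lemma green P e1 g1 e2 g2 : P^T = P ->
  is_primitive e1 g1 -> is_primitive e2 g2 ->
  ipL2 a b e1 (fun x => P *m g2 x) + ipL2 a b e2 (fun x => P *m g1 x) =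
  ipRn (e1 b) (P *m e2 b) - ipRn (e1 a) (P *m e2 a).
Proof.
move=> PT p1 p2; rewrite -(ipL2_by_parts p1 (primitive_mulmx P p2)).
congr (_ + _); rewrite ipL2C ipL2_mulmx ?PT//; first exact: p1.1.
exact: primitive_isL2 p2.
Qed.

(** For symmetric P the mixed terms between a and b cancel and the others double; the two factors
    1/sqrt 2 absorb the 2. The right side is dt times the boundary term of Green's formula. *)
Lemma boundary_pairing P (dt : R) (a1 b1 a2 b2 : 'cV[R]_n) : P^T = P ->
  ipRn ((Num.sqrt 2)^-1 *: (b1 + a1))
       ((Num.sqrt 2)^-1 *: (dt *: (P *m (b2 - a2)))) +
  ipRn ((Num.sqrt 2)^-1 *: (b2 + a2))
       ((Num.sqrt 2)^-1 *: (dt *: (P *m (b1 - a1)))) =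
  dt * (ipRn b1 (P *m b2) - ipRn a1 (P *m a2)).
Proof.
move=> PT.
have sym u v : ipRn u (P *m v) = ipRn v (P *m u).
  by rewrite ipRnC ipRn_mulmx PT.
have ss : (Num.sqrt 2)^-1 * (Num.sqrt 2)^-1 = 2^-1 :> R.
  by rewrite -invfM -expr2 sqr_sqrtr.
rewrite !ipRnZl !ipRnZr !mulrA ss -(scaleN1r a1) -(scaleN1r a2).
rewrite !mulmxDr -!scalemxAr !ipRnDl !ipRnDr !ipRnZr.
by rewrite (sym b2 b1) (sym b2 a1) (sym a2 b1) (sym a2 a1); field.
Qed.

Lemma ipL2_skew P e f : P^T = - P -> isL2 a b e -> isL2 a b f ->
  ipL2 a b e (fun x => P *m f x) + ipL2 a b f (fun x => P *m e x) = 0.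
Proof.
move=> PT se sf; rewrite (ipL2C a b f) ipL2_mulmx// PT.
under [X in _ + ipL2 _ _ _ X]eq_fun do rewrite mulNmx -scaleN1r.
by rewrite ipL2Zr ?mulN1r ?subrr//; exact: isL2_mulmx.
Qed.

End green.

(** * The Dirac structure: isotropy and maximality *)

Section dirac.
Context (R : realType) (a b : R) (n : nat) (P1 P0 : 'M[R]_n).
Context (Z : completeNormedModType R) (ip : Z -> Z -> R).
Context (H : Z -> R -> 'cV[R]_n) (Hs : (R -> 'cV[R]_n) -> Z) (dt : R).
Hypotheses (ab : a < b) (P1T : P1^T = P1) (P1u : P1 \in unitmx).
Hypotheses (P0T : P0^T = - P0) (ip_hilbert : hilbert_ip ip).
Hypotheses (H_L2 : forall z, isL2 a b (H z)) (HsP : is_adjoint a b ip H Hs).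
Hypothesis dt_gt0 : 0 < dt.
Implicit Types (x v : bond R n Z) (e g : R -> 'cV[R]_n).

Let leab : a <= b. Proof. exact: ltW. Qed.

(** Testing with u = z - w gives |z - w|^2 = 0. *)
Lemma hilbert_ip_inj (z w : Z) : (forall u, ip z u = ip w u) -> z = w.
Proof.
have [_ [ipD ipN]] := ip_hilbert => zw; apply/eqP; rewrite -subr_eq0 -normr_eq0.
by rewrite -sqrf_eq0 -ipN addrC -scaleN1r ipD zw mulN1r addNr.
Qed.

(* Unlike in inD, the P0 term uses e_eps itself rather than its absolutely
   continuous representative, so flow also applies to elements not yet known to
   have e_eps in H^1. *)
Definition flow x g : Prop := [/\ isL2 a b (ee x), isL2 a b (dfe x), isL2 a b g &
  Defs.ae_eq a b (dfe x)
    (fun t => dt *: (P1 *m g t + P0 *m ee x t) + H (dfw x) t)].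

Lemma ipL2_flow f x g : isL2 a b f -> flow x g ->
  ipL2 a b f (dfe x) = dt * (ipL2 a b f (fun t => P1 *m g t) +
    ipL2 a b f (fun t => P0 *m ee x t)) + ip (Hs f) (dfw x).
Proof.
move=> sf [se sd sg dE].
have s1 := isL2_mulmx P1 sg; have s0 := isL2_mulmx P0 se.
have s10 := isL2D s1 s0.
have sdt := isL2Z dt s10.
rewrite (ae_eq_ipL2r sd _ sf dE); last exact: isL2D sdt (H_L2 _).
by rewrite ipL2Dr// ipL2Zr// ipL2Dr// HsP.
Qed.

(** The P0 terms cancel by skew-symmetry, and the noise terms with [dfw x] cancel because v
    satisfies the noise effort equation. Nothing is assumed on [ew x], so the formula serves both
    inclusions. *)
Lemma pairing_flow x v gx gv : flow x gx -> flow v gv -> ew v = Hs (ee v) ->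
  pairing a b ip x v =
  dt * (ipL2 a b (ee x) (fun t => P1 *m gv t) +
        ipL2 a b (ee v) (fun t => P1 *m gx t))
  + (ip (Hs (ee x)) (dfw v) - ip (ew x) (dfw v))
  - (ipRn (ep x) (dfp v) + ipRn (ep v) (dfp x)).
Proof.
move=> fx fv ewv; have [[sx _ _ _] [sv _ _ _]] := (fx, fv).
rewrite /pairing (ipL2_flow sx fv) (ipL2_flow sv fx) ewv.
have := ipL2_skew P0T sx sv; move=> /eqP; rewrite addr_eq0 => /eqP ->.
ring.
Qed.

Lemma inD_flow x : inD a b P1 P0 H Hs dt x ->
  exists eh g, ew x = Hs (ee x) /\
    [/\ flow x g, is_primitive a b eh g, Defs.ae_eq a b (ee x) eh,
    dfp x = (Num.sqrt 2)^-1 *: (dt *: (P1 *m (eh b - eh a))) &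
    ep x = (Num.sqrt 2)^-1 *: (eh b + eh a)].
Proof.
move=> [[sd se] [eh [g [[sg [ehE eE]] [dE [? [? ?]]]]]]].
exists eh, g; do 3 split=> //.
by apply: ae_lebesgueS2 dE eE => t dt_ et tab; rewrite dt_// et.
Qed.

Lemma inD_isotropic x v : inD a b P1 P0 H Hs dt x -> inD a b P1 P0 H Hs dt v ->
  pairing a b ip x v = 0.
Proof.
move=> /inD_flow[ex [gx [ewx [fx px exE dfpx epx]]]].
move=> /inD_flow[ev [gv [ewv [fv pv evE dfpv epv]]]].
rewrite (pairing_flow fx fv ewv) ewx subrr addr0.
have [[sx _ sgx _] [sv _ sgv _]] := (fx, fv).
have sex := primitive_isL2 leab px; have sev := primitive_isL2 leab pv.
(* Green's formula concerns the absolutely continuous representatives, so they replace the efforts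
   in the L^2 products. *)
rewrite (ae_eq_ipL2l sx sex _ exE); last exact: isL2_mulmx.
rewrite (ae_eq_ipL2l sv sev _ evE); last exact: isL2_mulmx.
by rewrite (green leab P1T px pv) epx epv dfpx dfpv boundary_pairing// subrr.
Qed.

(** The element of D with effort e, weak derivative g and noise flow w, used as a test element; here
    e is its own absolutely continuous representative. *)
Definition bond_of e g (w : Z) : bond R n Z :=
  Bond (fun t => dt *: (P1 *m g t + P0 *m e t) + H w t) w
    ((Num.sqrt 2)^-1 *: (dt *: (P1 *m (e b - e a)))) e (Hs e)
    ((Num.sqrt 2)^-1 *: (e b + e a)).

Lemma flow_bond_of e g w : is_primitive a b e g -> flow (bond_of e g w) g.
Proof.
move=> p; have se := primitive_isL2 leab p; have [sg _] := p.
split=> //=; last by apply: aeW.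
by apply: isL2D (H_L2 w); apply/isL2Z/isL2D; exact: isL2_mulmx.
Qed.

Lemma inD_bond_of e g w : is_primitive a b e g ->
  inD a b P1 P0 H Hs dt (bond_of e g w).
Proof.
move=> p; have [se sd sg _] := flow_bond_of w p; split=> //.
exists e, g; split; last by split=> //; exact: aeW.
by have [_ eE] := p; split=> //; split=> //; exact: aeW.
Qed.

Lemma inDperp_inD x : inDperp a b ip P1 P0 H Hs dt x -> inD a b P1 P0 H Hs dt x.
Proof.
move=> [[sd se] perp].
(* These choices solve the flow equation for the derivative: P1 g = u / dt. *)
pose u t := dfe x t + -1 *: (H (dfw x) t + dt *: (P0 *m ee x t)).
pose g t := invmx P1 *m (dt^-1 *: u t).
have dt0 : dt != 0 by rewrite gt_eqF.
have su : isL2 a b u.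
  by apply/isL2D => //; apply/isL2Z/isL2D => //; apply/isL2Z/isL2_mulmx.
have sg : isL2 a b g by apply/isL2_mulmx/isL2Z.
have P1g t : P1 *m g t = dt^-1 *: u t by rewrite mulKVmx.
have fx : flow x g.
  split=> //; apply: aeW => t _; rewrite P1g scalerDr scalerA divff// scale1r.
  by rewrite /u scaleN1r -addrA [X in _ + X]addrC subrK.
(* Since eh(a) = c and eh(b) = c + [vint a b g], this c is forced by eh(b) + eh(a) = sqrt 2 *
   [ep x]. *)
pose c := 2^-1 *: (Num.sqrt 2 *: ep x - vint a b g).
pose eh t := c + vint a t g.
have p : is_primitive a b eh g by exact: primitive_vint.
have seh := primitive_isL2 leab p.
have epE : ep x = (Num.sqrt 2)^-1 *: (eh b + eh a).
  rewrite /eh vintaa addr0 /c.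
  apply/colP => i; rewrite !mxE.
  have s2 : Num.sqrt 2 != 0 :> R by rewrite gt_eqF// sqrtr_gt0.
  by field.
(* Subtracting Green's formula for eh and e' from the orthogonality relation removes the terms with
   P1 g and with [ep x]. *)
have key e' g' w' (p' : is_primitive a b e' g') :
  dt * (ipL2 a b (ee x) (fun t => P1 *m g' t) -
        ipL2 a b eh (fun t => P1 *m g' t))
  + (ip (Hs (ee x)) w' - ip (ew x) w') =
  ipRn ((Num.sqrt 2)^-1 *: (e' b + e' a))
    (dfp x - (Num.sqrt 2)^-1 *: (dt *: (P1 *m (eh b - eh a)))).
  have := perp _ (inD_bond_of w' p').
  rewrite (pairing_flow fx (flow_bond_of w' p'))//= => E1.
  have := boundary_pairing dt (eh a) (eh b) (e' a) (e' b) P1T.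
  rewrite -(green leab P1T p p') -epE => E2.
  rewrite ipRnBr; lra.
(* A constant e' has derivative zero, which removes the L^2 terms. *)
have key_cst (u0 : 'cV[R]_n) w' : ip (Hs (ee x)) w' - ip (ew x) w' =
  ipRn ((Num.sqrt 2)^-1 *: (u0 + u0))
    (dfp x - (Num.sqrt 2)^-1 *: (dt *: (P1 *m (eh b - eh a)))).
  rewrite -(key _ _ w' (primitive_cst a b u0)) mulmx0 !ipL20r.
  by rewrite subrr mulr0 add0r.
have ewE : ew x = Hs (ee x).
  apply: hilbert_ip_inj => z; apply/esym/eqP; rewrite -subr_eq0 (key_cst 0).
  by rewrite addr0 scaler0 ipRnC ipRn0r.
have dfpE : dfp x = (Num.sqrt 2)^-1 *: (dt *: (P1 *m (eh b - eh a))).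
  apply/eqP; rewrite -subr_eq0; apply/eqP; apply: ipRn_eq0.
  set d := _ - _.
  (* The constant test function is the defect d itself, so the relation says that a positive
     multiple of |d|^2 vanishes. *)
  have := key_cst d 0; rewrite ewE subrr -/d ipRnZl ipRnDl -mulr2n => /esym/eqP.
  by rewrite mulf_eq0 invr_eq0 sqrtr_eq0 mulrn_eq0 lern0/= => /eqP.
have eE : Defs.ae_eq a b (ee x) eh.
  pose d t := ee x t + -1 *: eh t.
  have sNeh := isL2Z (-1) seh.
  have sdd : isL2 a b d := isL2D se sNeh.
  have d0 : ipL2 a b d d = 0.
    (* The test derivative g' = P1^-1 d makes P1 g' = d, so [key] reduces to dt * (<e, d> - <eh, d>)
       = 0. *)
    have p' := primitive_vint 0 (isL2_mulmx (invmx P1) sdd).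
    have := key _ _ 0 p'; rewrite ewE dfpE !subrr addr0 ipRn0r => /eqP.
    under eq_fun do rewrite mulKVmx//.
    rewrite mulf_eq0 (negPf dt0)/= => /eqP <-.
    by rewrite {1}/d ipL2Dl// ipL2Zl// mulN1r.
  apply: ae_lebesgueS (ipL2_eq0 sdd d0) => t dE /dE /eqP.
  by rewrite /d scaleN1r subr_eq0 => /eqP.
split=> //; exists eh, g; split; first by split=> //; split=> //; exact: p.2.
split; last by [].
have [_ _ _ dE] := fx.
(* Now that e = eh a.e., eh may replace e in the P0 term, as [inD] demands. *)
by apply: ae_lebesgueS2 dE eE => t dE eE tab; rewrite dE// eE.
Qed.

End dirac.

Theorem theorem2 (R : realType) (a b : R) (n : nat)
    (P1 P0 : 'M[R]_n) (Z : completeNormedModType R) (ip : Z -> Z -> R)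
    (H : Z -> R -> 'cV[R]_n) (Hs : (R -> 'cV[R]_n) -> Z) (dt : R) :
  a < b -> (0 < n)%N ->
  P1^T = P1 -> P1 \in unitmx -> P0^T = - P0 ->
  hilbert_ip ip ->
  bounded_op a b H ->
  is_adjoint a b ip H Hs ->
  0 < dt ->
  forall x : bond R n Z,
    inDperp a b ip P1 P0 H Hs dt x <-> inD a b P1 P0 H Hs dt x.
Proof.
move=> ab _ P1T P1u P0T ip_hilbert [H_L2 _] HsP dt_gt0 x; split.
  exact: inDperp_inD.
by move=> xD; split=> [|v vD]; [exact: xD.1|exact: inD_isotropic xD vD].
Qed.
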